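(* Let $(A,\cdot,D,Q)$ be an admissible commutative differential algebra and, for $q\in\mathbf{k}$, let $(A,\circ_q)$ be the induced Novikov algebra, $a\circ_q b=a\cdot(D+qQ)(b)$. Let $r\in A\otimes A$ be an antisymmetric solution of the admissible associative Yang-Baxter equation in $(A,\cdot,D,Q)$. Then: (a) Unconditionally, $r$ is a solution of the Novikov Yang-Baxter equation in $(A,\circ_{-\frac12})$. (b) If $Q$ is moreover a derivation on $(A,\cdot)$, then $r$ is a solution of the Novikov Yang-Baxter equation in $(A,\circ_q)$. In particular, if $r$ is an antisymmetric solution of the admissible associative Yang-Baxter equation in $(A,\cdot,D,-D)$, then $r$ is a solution of the Novikov Yang-Baxter equation in $(A,\circ_q)$.
   Context: $\mathbf{k}$ is a field of characteristic $0$; all vector spaces are over $\mathbf{k}$ and finite-dimensional. Admissible commutative differential algebra $(A,\cdot,D,Q)$: $(A,\cdot)$ is a commutative associative algebra, $D,Q:A\to A$ linear, $D(a\cdot b)=D(a)\cdot b+a\cdot D(b)$, $Q(a\cdot b)=Q(a)\cdot b-a\cdot D(b)$. Then $a\circ_q b=a\cdot(D+qQ)(b)$ is a Novikov product (i.e. $(a\circ b)\circ c-a\circ(b\circ c)=(b\circ a)\circ c-b\circ(a\circ c)$, $(a\circ b)\circ c=(a\circ c)\circ b$). The quadruple $(A,\cdot,D,-D)$ is always admissible. For a binary operation $*$ on $A$ and $r=\sum_i x_i\otimes y_i$ set $r_{13}*r_{23}=\sum_{i,j}x_i\otimes x_j\otimes y_i*y_j$, $r_{12}*r_{23}=\sum_{i,j}x_i\otimes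 y_i*x_j\otimes y_j$, $r_{13}*r_{12}=\sum_{i,j}x_i*x_j\otimes y_j\otimes y_i$. $r$ is antisymmetric if $\sum_i x_i\otimes y_i=-\sum_i y_i\otimes x_i$. The Novikov Yang-Baxter equation (NYBE) in a Novikov algebra $(A,\circ)$ is $r_{13}\circ r_{23}+r_{12}\star r_{23}+r_{13}\circ r_{12}=0$, where $a\star b=a\circ b+b\circ a$. The associative Yang-Baxter equation (AYBE) in $(A,\cdot)$ is $r_{13}\cdot r_{12}+r_{13}\cdot r_{23}-r_{12}\cdot r_{23}=0$. A solution of the admissible AYBE in $(A,\cdot,D,Q)$ is a solution $r$ of the AYBE in $(A,\cdot)$ with $(D\otimes\mathrm{id}-\mathrm{id}\otimes Q)(r)=0$ and $(\mathrm{id}\otimes D-Q\otimes\mathrm{id})(r)=0$. *)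

(* Defs.v *)
From HB Require Import structures.
From mathcomp Require Import all_boot all_order all_algebra.

Set Implicit Arguments.
Unset Strict Implicit.
Unset Printing Implicit Defensive.

Import GRing.Theory.
Local Open Scope ring_scope.

Reserved Notation "u '⊗' v" (at level 38, right associativity).

(* Tensor products of finite-dimensional spaces are modelled by coordinate
   matrices: t i j is the coefficient of t on e_i ⊗ f_j, where (e_i) and (f_j)
   are the bases vbasis {:U} and vbasis {:V}.  The universal property, which
   makes the choice of bases irrelevant, is tlift_tens and tensor_span. *)
Definition tensor (k : fieldType) (U V : vectType k) : Type :=
  'M[k]_(\dim {:U}, \dim {:V}).

HB.instance Definition _ (k : fieldType) (U V : vectType k) :=
  Vector.on (tensor U V).

Definition tens (k : fieldType) (U V : vectType k) (u : U) (v : V) :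
  tensor U V :=
  \matrix_(i, j) (coord (vbasis {:U}) i u * coord (vbasis {:V}) j v).

Notation "u ⊗ v" := (tens u v) : ring_scope.

(* The linear map on U ⊗ V induced by a bilinear f, that is,
   sum_i x_i ⊗ y_i |-> sum_i f x_i y_i; see tlift_sum. *)
Definition tlift (k : fieldType) (U V W : vectType k) (f : U -> V -> W)
  (t : tensor U V) : W :=
  \sum_i \sum_j t i j *: f (vbasis {:U})`_i (vbasis {:V})`_j.

Section TensorTheory.
Variables (k : fieldType) (U V : vectType k).

Lemma tens_is_bilinear :
  bilinear_for (GRing.Scale.Law.clone _ _ *:%R _)
    (GRing.Scale.Law.clone _ _ *:%R _) (@tens k U V).
Proof.
split=> [v a u1 u2|u a v1 v2]; apply/matrixP=> i j; rewrite !mxE linearP /=.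
  by rewrite mulrDl mulrA.
by rewrite mulrDr mulrCA.
Qed.

HB.instance Definition _ :=
  bilinear_isBilinear.Build k U V (tensor U V) *:%R *:%R (@tens k U V)
    tens_is_bilinear.

Lemma tlift_is_linear (W : vectType k) (f : U -> V -> W) : linear (tlift f).
Proof.
move=> a s t; rewrite /tlift scaler_sumr -big_split; apply: eq_bigr => i _ /=.
rewrite scaler_sumr -big_split; apply: eq_bigr => j _ /=.
by rewrite !mxE scalerDl scalerA.
Qed.

HB.instance Definition _ (W : vectType k) (f : U -> V -> W) :=
  GRing.isLinear.Build k (tensor U V) W *:%R (tlift f) (tlift_is_linear f).

Lemma tlift_tens (W : vectType k) (f : {bilinear U -> V -> W}) u v :
  tlift f (u ⊗ v) = f u v.
Proof.
rewrite [in RHS](coord_vbasis (memvf u)) linear_sumlz; apply: eq_bigr => i _.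
rewrite linearZl_LR [in RHS](coord_vbasis (memvf v)) linear_sumr scaler_sumr.
by apply: eq_bigr => j _; rewrite linearZr_LR scalerA mxE.
Qed.

Lemma tensor_span (t : tensor U V) :
  t = \sum_i \sum_j t i j *: ((vbasis {:U})`_i ⊗ (vbasis {:V})`_j).
Proof.
rewrite {1}[t]matrix_sum_delta; apply: eq_bigr => i _; apply: eq_bigr => j _.
congr (_ *: _); apply/matrixP=> i' j'; rewrite !mxE.
rewrite !(coord_free _ _ (basis_free (vbasisP _))) -natrM mulnb.
by rewrite (eq_sym i) (eq_sym j).
Qed.

Lemma eq_tlift (W : vectType k) (f g : U -> V -> W) :
  f =2 g -> tlift f =1 tlift g.
Proof.
by move=> fg t; apply: eq_bigr => i _; apply: eq_bigr => j _; rewrite fg.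
Qed.

Lemma tlift_sum (W : vectType k) (f : {bilinear U -> V -> W})
    (s : seq (U * V)) :
  tlift f (\sum_(p <- s) p.1 ⊗ p.2) = \sum_(p <- s) f p.1 p.2.
Proof. by rewrite linear_sum; apply: eq_bigr => p _; exact: tlift_tens. Qed.

(* Same, with bilinearity of f as a hypothesis. *)
Lemma tlift_sum_for (W : vectType k) (f : U -> V -> W) (s : seq (U * V)) :
  (forall v, linear (f ^~ v)) -> (forall u, linear (f u)) ->
  tlift f (\sum_(p <- s) p.1 ⊗ p.2) = \sum_(p <- s) f p.1 p.2.
Proof.
move=> fl fr; pose B := bilinear_isBilinear.Build k U V W *:%R *:%R f (fl, fr).
pose g : {bilinear U -> V -> W} := HB.pack f B.
exact: (tlift_sum g).
Qed.

End TensorTheory.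

Definition tswap (k : fieldType) (U V : vectType k) (t : tensor U V) :
  tensor V U := tlift (fun u v => v ⊗ u) t.

Definition tmap (k : fieldType) (U U' V V' : vectType k) (f : 'Hom(U, U'))
  (g : 'Hom(V, V')) (t : tensor U V) : tensor U' V' :=
  tlift (fun u v => f u ⊗ g v) t.

Section YangBaxter.
Variables (k : fieldType) (A : vectType k).
Implicit Types (op : A -> A -> A) (r : tensor A A).

Definition r13_r23 op r : tensor A (tensor A A) :=
  tlift (fun x y => tlift (fun x' y' => x ⊗ x' ⊗ op y y') r) r.

Definition r12_r23 op r : tensor A (tensor A A) :=
  tlift (fun x y => tlift (fun x' y' => x ⊗ op y x' ⊗ y') r) r.

Definition r13_r12 op r : tensor A (tensor A A) :=
  tlift (fun x y => tlift (fun x' y' => op x x' ⊗ y' ⊗ y) r) r.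

Definition antisymmetric_tensor r : Prop := r = - tswap r.

Definition star op (a b : A) : A := op a b + op b a.

Definition NYBE op r : Prop :=
  r13_r23 op r + r12_r23 (star op) r + r13_r12 op r = 0.

Definition AYBE op r : Prop :=
  r13_r12 op r + r13_r23 op r - r12_r23 op r = 0.

Definition admissible_AYBE op (D Q : 'End(A)) r : Prop :=
  [/\ AYBE op r,
      tmap D \1%VF r - tmap \1%VF Q r = 0
    & tmap \1%VF D r - tmap Q \1%VF r = 0].

End YangBaxter.

Section Algebras.
Variables (k : fieldType) (A : vectType k).
Implicit Types (mul : {bilinear A -> A -> A}) (D Q : 'End(A)).

Definition derivation mul D : Prop :=
  forall a b, D (mul a b) = mul (D a) b + mul a (D b).

Record comm_diff_algebra mul D : Prop := CommDiffAlgebra {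
  cda_assoc : associative mul;
  cda_comm : commutative mul;
  cda_deriv : derivation mul D
}.

Record admissible_cda mul D Q : Prop := AdmissibleCDA {
  acda_cda : comm_diff_algebra mul D;
  acda_adm : forall a b, Q (mul a b) = mul (Q a) b - mul a (D b)
}.

Record novikov (op : A -> A -> A) : Prop := Novikov {
  novikov_lsym : forall a b c,
    op (op a b) c - op a (op b c) = op (op b a) c - op b (op a c);
  novikov_rcomm : forall a b c, op (op a b) c = op (op a c) b
}.

Definition circ mul D Q (q : k) (a b : A) : A := mul a ((D + q *: Q) b).

Lemma circ_is_bilinear mul D Q q :
  bilinear_for (GRing.Scale.Law.clone _ _ *:%R _)
    (GRing.Scale.Law.clone _ _ *:%R _) (circ mul D Q q).
Proof.
split=> [b a x y|b a x y]; rewrite /circ; first exact: linearPl.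
by rewrite linearP /= linearPr.
Qed.

HB.instance Definition _ mul D Q q :=
  bilinear_isBilinear.Build k A A A *:%R *:%R (circ mul D Q q)
    (circ_is_bilinear mul D Q q).

Lemma circ_novikov mul D Q q : admissible_cda mul D Q ->
  novikov (circ mul D Q q).
Proof.
case=> -[mulA mulC mulD] mulQ.
have mulCA a b c : mul a (mul b c) = mul b (mul a c).
  by rewrite !mulA (mulC a).
rewrite /circ; set P := D + q *: Q.
have PE a b : P (mul a (P b)) = mul (P a) (P b) + (1 - q) *: mul a (D (P b)).
  rewrite {1 3}/P !lfunE /= !lfunE /= mulD mulQ linearDl /= linearZl_LR.
  by rewrite scalerBr scalerBl scale1r -!addrA; congr (_ + _); rewrite addrCA.
split=> a b c; last by rewrite -!mulA [mul (P b) _]mulC.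
rewrite !PE !linearDr /= !linearZr_LR !mulA !opprD !addrA.
by rewrite !subrr !sub0r -!mulA mulCA.
Qed.

Lemma admissible_opp mul D :
  comm_diff_algebra mul D -> admissible_cda mul D (- D).
Proof.
move=> H; split=> // a b; rewrite !lfunE /= (cda_deriv H) opprD.
by rewrite linearNl.
Qed.

End Algebras.

(* The defining formulas on an arbitrary decomposition r = sum_i x_i ⊗ y_i. *)
Section Decompositions.
Variables (k : fieldType) (A : vectType k) (s : seq (A * A)).
Let r : tensor A A := \sum_(p <- s) p.1 ⊗ p.2.

Lemma tswap_sum : tswap r = \sum_(p <- s) p.2 ⊗ p.1.
Proof.
apply: tlift_sum_for => [v|u] a x y; [exact: linearPr | exact: linearPl].
Qed.

Lemma tmap_sum (f g : 'End(A)) : tmap f g r = \sum_(p <- s) f p.1 ⊗ g p.2.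
Proof.
apply: tlift_sum_for => [v|u] a x y; rewrite linearP.
  exact: linearPl.
exact: linearPr.
Qed.

Lemma tlift2_sum (W : vectType k) (F : A -> A -> A -> A -> W) :
  (forall y x' y', linear (fun x => F x y x' y')) ->
  (forall x x' y', linear (fun y => F x y x' y')) ->
  (forall x y y', linear (fun x' => F x y x' y')) ->
  (forall x y x', linear (fun y' => F x y x' y')) ->
  tlift (fun x y => tlift (F x y) r) r =
    \sum_(p <- s) \sum_(p' <- s) F p.1 p.2 p'.1 p'.2.
Proof.
move=> F1 F2 F3 F4.
have E x y : tlift (F x y) r = \sum_(p' <- s) F x y p'.1 p'.2.
  by apply: tlift_sum_for => [v|u]; [exact: F3 | exact: F4].
rewrite (eq_tlift E); apply: tlift_sum_for => [v|u] a x y;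
  rewrite scaler_sumr -big_split; apply: eq_bigr => p _ /=.
  exact: F1.
exact: F2.
Qed.

Variable op : {bilinear A -> A -> A}.

Lemma r13_r23_sum : r13_r23 op r =
  \sum_(p <- s) \sum_(p' <- s) p.1 ⊗ p'.1 ⊗ op p.2 p'.2.
Proof.
apply: (tlift2_sum (F := fun x y x' y' => x ⊗ x' ⊗ op y y')) => ? ? ? ? ? ?;
  by rewrite ?linearPl ?linearPr // ?linearPl ?linearPr // linearPr.
Qed.

Lemma r12_r23_sum : r12_r23 op r =
  \sum_(p <- s) \sum_(p' <- s) p.1 ⊗ op p.2 p'.1 ⊗ p'.2.
Proof.
apply: (tlift2_sum (F := fun x y x' y' => x ⊗ op y x' ⊗ y')) => ? ? ? ? ? ?;
  by rewrite ?linearPl ?linearPr // ?linearPl ?linearPr // linearPr.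
Qed.

Lemma r13_r12_sum : r13_r12 op r =
  \sum_(p <- s) \sum_(p' <- s) op p.1 p'.1 ⊗ p'.2 ⊗ p.2.
Proof.
apply: (tlift2_sum (F := fun x y x' y' => op x x' ⊗ y' ⊗ y)) => ? ? ? ? ? ?;
  by rewrite ?linearPl ?linearPr // ?linearPl ?linearPr // linearPr.
Qed.

End Decompositions.

(* Main.v *)
Require Import Defs.
From HB Require Import structures.
From mathcomp Require Import all_boot all_order all_algebra.

Set Implicit Arguments.
Unset Strict Implicit.
Unset Printing Implicit Defensive.

Import GRing.Theory.
Local Open Scope ring_scope.

(** Put P = D + qQ and P' = Q + qD.  Admissibility of r moves P from one leg of
    r to P' on the other, so the outer two terms of the NYBE become the image
    under id ⊗ P' ⊗ id of r13 r23 + r13 r12, which is r12 r23 by the AYBE.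
    Hence the left side of the NYBE is the sum of the
      x_i ⊗ (P'(y_i x_j) + y_i P(x_j) + x_j P(y_i)) ⊗ y_j.
    Computing Q(ab) = Q(ba) in two ways gives (D + Q)(a) b = a (D + Q)(b), so
    the middle leg is (1 + 2q) (D + Q)(y_i) x_j.  The scalar vanishes for
    q = -1/2, while (D + Q)(a) b = 0 as soon as Q is also a derivation. *)

Section TensorSums.
Variables (k : fieldType) (U V : vectType k).

(** Gives access to the formulas on decompositions for an arbitrary [r]; coefficients are absorbed
    into the first leg. *)
Lemma tensor_decomposition (t : tensor U V) :
  exists s : seq (U * V), t = \sum_(p <- s) p.1 ⊗ p.2.
Proof.
exists [seq (t i j *: (vbasis {:U})`_i, (vbasis {:V})`_j)
  | i <- enum 'I_(\dim {:U}), j <- enum 'I_(\dim {:V})].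
rewrite big_allpairs_dep /= big_enum {1}[t]tensor_span; apply: eq_bigr => i _.
by rewrite big_enum; apply: eq_bigr => j _; rewrite linearZl_LR.
Qed.

Lemma tlift_tens_for (W : vectType k) (f : U -> V -> W) u v :
  (forall v, linear (f ^~ v)) -> (forall u, linear (f u)) ->
  tlift f (u ⊗ v) = f u v.
Proof.
by move=> fl fr; have := tlift_sum_for [:: (u, v)] fl fr; rewrite !big_seq1.
Qed.

End TensorSums.

Section Star.
Variables (k : fieldType) (A : vectType k) (op : {bilinear A -> A -> A}).

(** Makes [r12_r23_sum] applicable to the middle term of the NYBE. *)
Lemma star_is_bilinear :
  bilinear_for (GRing.Scale.Law.clone _ _ *:%R _)
    (GRing.Scale.Law.clone _ _ *:%R _) (star op).
Proof.
by split=> b a x y; rewrite /star linearPl linearPr /= scalerDr addrACA.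
Qed.

HB.instance Definition _ :=
  bilinear_isBilinear.Build k A A A *:%R *:%R (star op) star_is_bilinear.

End Star.

Section MiddleLeg.
Variables (k : fieldType) (A : vectType k).

(** The operator id ⊗ g ⊗ id on the triple tensor product. *)
Definition map_middle (g : 'End(A)) :
    tensor A (tensor A A) -> tensor A (tensor A A) :=
  tlift (fun x t => x ⊗ tlift (fun y z => g y ⊗ z) t).

HB.instance Definition _ g :=
  GRing.Linear.copy (map_middle g)
    (tlift (fun x t => x ⊗ tlift (fun y z => g y ⊗ z) t)).

Lemma map_middle_tens g x y z : map_middle g (x ⊗ y ⊗ z) = x ⊗ g y ⊗ z.
Proof.
rewrite /map_middle tlift_tens_for => [|v|u] => [|a u w|a v w].
- rewrite tlift_tens_for // => [v|u] a u1 u2; first by rewrite linearP linearPl.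
  exact: linearPr.
- exact: linearPl.
- by rewrite linearP linearPr.
Qed.

End MiddleLeg.

Section Transfer.
Variables (k : fieldType) (A : vectType k) (s : seq (A * A)).
Let r : tensor A A := \sum_(p <- s) p.1 ⊗ p.2.

(** Apply the linear map induced by [F] to the tensor identity. This is how an operator changes legs
    inside a larger expression. *)
Lemma sum_transfer (W : vectType k) (F : A -> A -> W) (f g : 'End(A)) :
  (forall v, linear (F ^~ v)) -> (forall u, linear (F u)) ->
  tmap f \1%VF r = tmap \1%VF g r ->
  \sum_(p <- s) F (f p.1) p.2 = \sum_(p <- s) F p.1 (g p.2).
Proof.
move=> Fl Fr; rewrite !tmap_sum => /(congr1 (tlift F)); rewrite !linear_sum /=.
under eq_bigr do rewrite tlift_tens_for // id_lfunE.
by move=> ->; apply: eq_bigr => p _; rewrite tlift_tens_for // id_lfunE.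
Qed.

Lemma tmap_comb (f g f' g' : 'End(A)) (q : k) :
  tmap f \1%VF r = tmap \1%VF f' r -> tmap g \1%VF r = tmap \1%VF g' r ->
  tmap (f + q *: g) \1%VF r = tmap \1%VF (f' + q *: g') r.
Proof.
rewrite !tmap_sum => Ef Eg.
under eq_bigr do rewrite add_lfunE scale_lfunE linearDl /= linearZl_LR.
under [RHS]eq_bigr do rewrite add_lfunE scale_lfunE linearDr /= linearZr_LR.
by rewrite !big_split /= -!scaler_sumr Ef Eg.
Qed.

End Transfer.

Section Admissible.
Variables (k : fieldType) (A : vectType k) (mul : {bilinear A -> A -> A}).
Variables D Q : 'End(A).
Hypothesis adm : admissible_cda mul D Q.

Lemma admissible_sym a b : mul ((D + Q) a) b = mul a ((D + Q) b).
Proof.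
case: adm => -[_ mulC _] mulQ.
have /eqP := mulQ a b; rewrite mulC mulQ (mulC b) (mulC _ a).
rewrite eq_sym subr_eq addrAC eq_sym subr_eq => /eqP E.
by rewrite !add_lfunE linearDl linearDr /= [LHS]addrC [RHS]addrC.
Qed.

Lemma admissible_derivation_eq0 a b :
  derivation mul Q -> mul ((D + Q) a) b = 0.
Proof.
move=> derQ; rewrite admissible_sym lfunE /= linearDr /=.
(* Comparing the two expansions of Q(ab) gives a Q(b) = - a D(b). *)
have := derQ a b; rewrite (acda_adm adm) => /addrI <-; exact: subrr.
Qed.

(** On expansion the terms ± a D(b) cancel, leaving (D + Q)(a) b + q ((D + Q)(a) b + a (D + Q)(b));
    [admissible_sym] merges the last two products. *)
Lemma middle_leg q a b :
  (Q + q *: D) (mul a b) + star (circ mul D Q q) a b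
    = (1 + q *+ 2) *: mul ((D + Q) a) b.
Proof.
case: adm => -[_ mulC mulD] mulQ.
have := admissible_sym a b.
rewrite /star /circ !add_lfunE !scale_lfunE mulQ mulD linearDl !linearDr /=.
rewrite !linearZr_LR /= (mulC b (D a)) (mulC b (Q a)) => E.
(* Only one of the two q-multiples on the right is turned into a (D + Q)(b), to match the expanded
   left side. *)
rewrite addrACA subrKA mulr2n scalerDl scale1r [in RHS]scalerDl {3}E.
by rewrite !scalerDr [LHS](AC (2*(2*2)) ((5*1)*((3*6)*(4*2)))).
Qed.

(** All cases share this reduction and differ only in why the middle leg vanishes, so that vanishing
    is a hypothesis. *)
Lemma NYBE_admissible q (r : tensor A A) :
  admissible_AYBE mul D Q r ->
  (forall a b, (1 + q *+ 2) *: mul ((D + Q) a) b = 0) ->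
  NYBE (circ mul D Q q) r.
Proof.
have [s ->] := tensor_decomposition r.
case=> aybe /eqP; rewrite subr_eq0 => /eqP DQ /eqP; rewrite subr_eq0 => /eqP QD.
move=> mid0.
(* P on the first leg of [r] is P' on the second, and P' on the first is P on the second. *)
have PP' := tmap_comb q DQ (esym QD).
have P'P := tmap_comb q (esym QD) DQ.
have E3 : r13_r12 (circ mul D Q q) (\sum_(p <- s) p.1 ⊗ p.2) =
    map_middle (Q + q *: D) (r13_r12 mul (\sum_(p <- s) p.1 ⊗ p.2)).
  rewrite !r13_r12_sum linear_sum; apply: eq_bigr => p _; rewrite linear_sum /=.
  under [RHS]eq_bigr do rewrite map_middle_tens.
  (* With [p] fixed, P acts on x' and its partner y' is the middle leg. *)
  apply: (sum_transfer (F := fun x' y' => mul p.1 x' ⊗ y' ⊗ p.2) _ _ PP');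
    by move=> ? ? ? ?; rewrite ?linearPl ?linearPr // ?linearPl ?linearPr.
have E1 : r13_r23 (circ mul D Q q) (\sum_(p <- s) p.1 ⊗ p.2) =
    map_middle (Q + q *: D) (r13_r23 mul (\sum_(p <- s) p.1 ⊗ p.2)).
  rewrite !r13_r23_sum linear_sum; apply: eq_bigr => p _; rewrite linear_sum /=.
  under [RHS]eq_bigr do rewrite map_middle_tens.
  (* Here P acts on y' and x' is the middle leg, hence the reversed use. *)
  apply/esym/(sum_transfer (F := fun x' y' => p.1 ⊗ x' ⊗ mul p.2 y') _ _ P'P);
    by move=> ? ? ? ?; rewrite ?linearPl ?linearPr // ?linearPl ?linearPr.
move/eqP: aybe; rewrite subr_eq0 => /eqP aybe.
rewrite /NYBE addrAC E1 E3 -linearD /= [X in map_middle _ X]addrC aybe.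
rewrite !r12_r23_sum linear_sum -big_split big1 // => p _ /=.
rewrite linear_sum -big_split big1 // => p' _ /=.
rewrite map_middle_tens -linearDr -linearDl /= middle_leg mid0.
by rewrite linear0l linear0r.
Qed.

End Admissible.

Theorem proposition3p4 (k : fieldType) (k_char0 : [pchar k] =i pred0)
    (A : vectType k) (mul : {bilinear A -> A -> A}) :
  (forall (D Q : 'End(A)) (r : tensor A A),
     admissible_cda mul D Q ->
     antisymmetric_tensor r -> admissible_AYBE mul D Q r ->
     NYBE (circ mul D Q (- (1 / 2%:R))) r /\
     (derivation mul Q -> forall q : k, NYBE (circ mul D Q q) r))
  /\
  (forall (D : 'End(A)) (r : tensor A A),
     comm_diff_algebra mul D ->
     antisymmetric_tensor r -> admissible_AYBE mul D (- D) r ->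
     forall q : k, NYBE (circ mul D (- D) q) r).
Proof.
split=> [D Q r adm _ aybe | D r cda _ aybe q].
  split=> [|derQ q]; apply: NYBE_admissible => // a b; last first.
    by rewrite admissible_derivation_eq0 // scaler0.
  (* Characteristic 0 makes 2 invertible, so 1 + 2q = 0 at q = -1/2. *)
  have nz2 : 2%:R != 0 :> k by rewrite ((pcharf0P k).1 k_char0).
  by rewrite -[X in 1 + X]mulr_natr mulNr divfK // subrr scale0r.
apply: NYBE_admissible => // [|a b]; first exact: admissible_opp.
(* For Q = -D the operator D + Q is itself zero. *)
by rewrite subrr zero_lfunE linear0l scaler0.
Qed.
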